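(* There exist two countable totally ordered sets that are isotypic (as structures in the language $\{<\}$ of ordered sets) but not isomorphic.
   Context: Let $\mathcal L$ be a first-order language and $A$ an $\mathcal L$-structure. For a finite tuple $\bar a=(a_1,\ldots,a_k)$ of elements of $A$, the type $\mathrm{tp}_A(\bar a)$ is the set of all first-order $\mathcal L$-formulas (without parameters) in $k$ free variables that hold in $A$ at $\bar a$. Two $\mathcal L$-structures $A$ and $B$ are isotypic if for every finite tuple $\bar a=(a_1,\ldots,a_k)$ over $A$ there is a tuple $\bar b=(b_1,\ldots,b_k)$ over $B$ of the same length with $\mathrm{tp}_A(\bar a)=\mathrm{tp}_B(\bar b)$, and vice versa (for every finite tuple over $B$ there is a tuple over $A$ of the same length with the same type). *)

(* Defs.v *)
From HB Require Import structures.
From mathcomp Require Import all_boot all_order.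
From mathcomp Require Import boolp classical_sets functions cardinality.

Set Implicit Arguments.
Unset Strict Implicit.
Unset Printing Implicit Defensive.

Local Open Scope classical_set_scope.

Record language := Language {
  func_symb : Type;
  func_arity : func_symb -> nat;
  rel_symb : Type;
  rel_arity : rel_symb -> nat }.

Record structure (L : language) := Structure {
  carrier :> Type;
  func_interp : forall f : func_symb L, (func_arity f).-tuple carrier -> carrier;
  rel_interp : forall r : rel_symb L, (rel_arity r).-tuple carrier -> Prop }.

(* [term L k] and [formula L k] are well scoped: the variables are those of 'I_k. *)
Inductive term (L : language) (k : nat) : Type :=
| Var of 'I_k
| App (f : func_symb L) (ts : 'I_(func_arity f) -> term L k).

(* [Forall] binds variable 0 of its body and shifts the other variables by one.
   The remaining connectives and the existential quantifier are classically
   definable from these. *)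
Inductive formula (L : language) : nat -> Type :=
| Falsum k : formula L k
| Equal k of term L k & term L k : formula L k
| Rel k (r : rel_symb L) (ts : 'I_(rel_arity r) -> term L k) : formula L k
| Imp k of formula L k & formula L k : formula L k
| Forall k of formula L k.+1 : formula L k.

Fixpoint eval (L : language) (A : structure L) (k : nat) (a : k.-tuple A)
    (t : term L k) : A :=
  match t with
  | Var i => tnth a i
  | App f ts => func_interp [tuple eval a (ts i) | i < func_arity f]
  end.

Fixpoint sat (L : language) (A : structure L) (k : nat) (phi : formula L k) :
    k.-tuple A -> Prop :=
  match phi in formula _ k return k.-tuple A -> Prop with
  | Falsum _ => fun=> False
  | Equal _ s t => fun a => eval a s = eval a t
  | Rel _ r ts => fun a => rel_interp [tuple eval a (ts i) | i < rel_arity r]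
  | Imp _ phi psi => fun a => sat phi a -> sat psi a
  | Forall _ phi => fun a => forall x : A, sat phi [tuple of x :: a]
  end.

Definition tp (L : language) (A : structure L) (k : nat) (a : k.-tuple A) :
  set (formula L k) := [set phi | sat phi a].

Definition isotypic (L : language) (A B : structure L) : Prop :=
  (forall (k : nat) (a : k.-tuple A), exists b : k.-tuple B, tp a = tp b) /\
  (forall (k : nat) (b : k.-tuple B), exists a : k.-tuple A, tp a = tp b).

Definition isomorphic (L : language) (A B : structure L) : Prop :=
  exists h : A -> B,
    [/\ bijective h,
        forall (f : func_symb L) (a : (func_arity f).-tuple A),
          h (func_interp a) = func_interp (map_tuple h a) &
        forall (r : rel_symb L) (a : (rel_arity r).-tuple A),
          rel_interp a <-> rel_interp (map_tuple h a)].

Definition order_language : language :=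
  {| func_symb := void; func_arity := fun=> 0;
     rel_symb := unit; rel_arity := fun=> 2 |}.

Definition order_structure (d : Order.disp_t) (T : orderType d) :
    structure order_language :=
  @Structure order_language T
    (fun f : void => match f with end)
    (fun (_ : unit) (a : 2.-tuple T) => (tnth a ord0 < tnth a ord_max)%O).

(* Main.v *)
Require Import Defs.
From mathcomp Require Import all_boot all_order all_algebra.
From mathcomp Require Import boolp classical_sets functions cardinality zify.

Import Order.TTheory GRing.Theory Num.Theory.

(** Replace every point of a linear order I by a copy of the integers: this
    gives [blocks I], a discrete order without endpoints.  The integers act on
    it by [shift], and first-order formulas see only the order and finite
    distances: two points of the same block are told apart by their offset, two
    points of different blocks are just infinitely far from each other, and
    nothing expresses how many blocks lie between them.  Hence the type of a
    tuple of [blocks I] depends only on the order of the blocks that it meets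
    and on the positions inside them ([tp_blocks]).

    Take I to be the natural numbers for A, the integers for B.  A finite tuple
    meets finitely many blocks, and finitely many integers can be translated
    into the naturals, so A and B realize the same types.  They are not
    isomorphic: an isomorphism preserves successors, hence maps blocks to
    blocks, but A has a first block and B has none.

    The statement on types is proved by a back-and-forth argument with bounded
    precision.  The tuples a and b are m-close when the order of their entries
    agrees even after shifts by at most m.  When a and b agree with precision a
    little above 2m, any point added to a is matched by a point added to b so
    that the longer tuples are m-close ([close_extend]).  By induction, for each
    formula there is an m such that m-close tuples satisfy it together
    ([close_sat]). *)

Set Implicit Arguments.
Unset Strict Implicit.

Local Open Scope classical_set_scope.

Definition blocks (d : Order.disp_t) (I : orderType d) := (I *l int)%type.

Section Shift.
Context {d : Order.disp_t} {I : orderType d}.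
Implicit Types (x y : blocks I) (c e : int).

Definition shift c x : blocks I := (x.1, x.2 + c)%R.

Lemma shift0 x : shift 0%R x = x.
Proof. by case: x => i z; rewrite /shift /= addr0. Qed.

Lemma shiftD c e x : shift c (shift e x) = shift (e + c)%R x.
Proof. by rewrite /shift /= addrA. Qed.

Lemma lt_shift2 c x y : (shift c x < shift c y)%O = (x < y)%O.
Proof. by rewrite !ltEprodlexi /= ltrD2r. Qed.

Lemma lt_shiftl c x y : (shift c x < y)%O = (x < shift (- c)%R y)%O.
Proof. by rewrite -(lt_shift2 (- c)%R) shiftD subrr shift0. Qed.

Lemma lt_shift_self c e x : (shift c x < shift e x)%O = (c < e)%R.
Proof. by rewrite ltEprodlexi /= lexx /= ltrD2l. Qed.

(** Discreteness: [shift 1] is the immediate successor. *)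
Lemma le_shift1 x y : (shift 1%R x <= y)%O = (x < y)%O.
Proof.
rewrite leEprodlexi ltEprodlexi /=; congr (_ && (_ ==> _)).
lia.
Qed.

Lemma lt_shift1 x y : (x < shift 1%R y)%O = (x <= y)%O.
Proof. by rewrite ltNge le_shift1 -leNgt. Qed.

End Shift.

Section BackAndForth.
Context {dI dJ : Order.disp_t} {I : orderType dI} {J : orderType dJ}.

(** Allowing shifts on one side only loses nothing, since shifting both sides
    preserves the order; negative c covers shifts of the other entry. *)
Definition close m k (a : k.-tuple (blocks I)) (b : k.-tuple (blocks J)) :=
  forall (i j : 'I_k) (c : int), `|c|%N <= m ->
    (tnth a i < shift c (tnth a j))%O = (tnth b i < shift c (tnth b j))%O.

Lemma close_sub m n k (a : k.-tuple (blocks I)) (b : k.-tuple (blocks J)) :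
  n <= m -> close m a b -> close n a b.
Proof. by move=> le_nm ab i j c le_cn; apply: ab; apply: leq_trans le_nm. Qed.

Lemma close_lt_shift m k (a : k.-tuple (blocks I)) (b : k.-tuple (blocks J)) :
  close m a b ->
  forall (i j : 'I_k) (c e : int), `|(c - e)%R|%N <= m ->
    (shift e (tnth a i) < shift c (tnth a j))%O =
    (shift e (tnth b i) < shift c (tnth b j))%O.
Proof. by move=> ab i j c e le_cem; rewrite !lt_shiftl !shiftD ab. Qed.

(** Consider the points at distance at most m from an entry of a, and the
    corresponding points for b.  There are finitely many, ordered in the same
    way on both sides, so x is placed by the largest of them that is at most x:
    it is matched by the corresponding point if x equals it, by the successor of
    that point otherwise.  If they are all above x, any point below all their
    counterparts will do.  Comparing the points takes shifts by up to 2m, and using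
    successors takes one more. *)
Lemma same_cut m k (a : k.-tuple (blocks I)) (b : k.-tuple (blocks J))
    (x : blocks I) (y0 : blocks J) :
  close (m.*2.+1) a b ->
  exists y : blocks J, forall (j : 'I_k) (c : int), `|c|%N <= m ->
    (x < shift c (tnth a j))%O = (y < shift c (tnth b j))%O.
Proof.
move=> ab.
(* [(j, u) : T] stands for the j-th entry shifted by u - m. *)
pose T := ('I_k * 'I_m.*2.+1)%type.
pose off (t : T) : int := (Posz t.2 - Posz m)%R.
pose pa (t : T) := shift (off t) (tnth a t.1).
pose pb (t : T) := shift (off t) (tnth b t.1).
suff [y yP] : exists y : blocks J, forall t : T, (x < pa t)%O = (y < pb t)%O.
  exists y => j c le_cm.
  have lt_cm : `|(c + Posz m)%R|%N < m.*2.+1 by lia.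
  have := yP (j, Ordinal lt_cm); rewrite /pa /pb /off /=.
  by have -> : (Posz `|(c + Posz m)%R|%N - Posz m)%R = c by lia.
have off_small (s t : T) e : `|e|%N <= 1 -> `|(off s - (off t + e))%R|%N <= m.*2.+1.
  by rewrite /off; have := ltn_ord s.2; have := ltn_ord t.2; lia.
have pab s t : (pa s < pa t)%O = (pb s < pb t)%O.
  by apply: close_lt_shift ab _ _ _ _ _; have := off_small t s 0%R isT; rewrite addr0.
have pab1 s t : (shift 1%R (pa s) < pa t)%O = (shift 1%R (pb s) < pb t)%O.
  by rewrite /pa /pb !shiftD; apply: close_lt_shift ab _ _ _ _ (off_small t s 1%R isT).
have [[t0 t0x] | no_le] := pselect (exists t, (pa t <= x)%O); last first.
  have above t : (x < pa t)%O by rewrite ltNge; apply/negP => le; apply: no_le; exists t.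
  have [[t0 _] | T0] := pselect (exists t : T, True); last first.
    by exists y0 => t; case: T0; exists t.
  case: (@arg_minP _ _ _ t0 predT pb isT) => s _ s_min.
  exists (shift (-1)%R (pb s)) => t; rewrite above lt_shiftl opprK lt_shift1.
  by rewrite s_min.
case: (@arg_maxP _ _ _ t0 (fun t => (pa t <= x)%O) pa t0x) => s sx s_max.
move: sx; rewrite le_eqVlt => /predU1P[sx | sx].
  by exists (pb s) => t; rewrite -sx pab.
exists (shift 1%R (pb s)) => t; rewrite -pab1.
have [le_tx | lt_xt] := leP (pa t) x; last first.
  by apply/esym/(le_lt_trans _ lt_xt); rewrite le_shift1.
apply/esym/negbTE; rewrite -leNgt; apply: le_trans (s_max _ le_tx) _.
by apply: ltW; rewrite lt_shift1.
Qed.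

(** The comparisons x < shift c (a j) with |c| <= m + 1 determine all the others:
    a j < shift c x is the negation of x < shift (1 - c) (a j), which is why the
    cut is matched with precision m + 1. *)
Lemma close_extend m k (a : k.-tuple (blocks I)) (b : k.-tuple (blocks J))
    (x : blocks I) (y0 : blocks J) :
  close (m.+1.*2.+1) a b ->
  exists y : blocks J, close m [tuple of x :: a] [tuple of y :: b].
Proof.
move=> ab; have [y xy] := same_cut x y0 ab; exists y => i j c le_cm.
case: (unliftP ord0 i) => [i' ->|->]; case: (unliftP ord0 j) => [j' ->|->];
  rewrite ?tnthS ?tnth0.
- by apply: ab; lia.
- rewrite -[c]opprK -!lt_shiftl -!le_shift1 !shiftD !leNgt xy //; lia.
- by apply: xy; lia.
- by rewrite -{1}(shift0 x) -{1}(shift0 y) !lt_shift_self.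
Qed.

End BackAndForth.

Lemma close_sym dI dJ (I : orderType dI) (J : orderType dJ) m k
    (a : k.-tuple (blocks I)) (b : k.-tuple (blocks J)) :
  close m a b -> close m b a.
Proof. by move=> ab i j c le_cm; rewrite ab. Qed.

(** The points i0 and j0 make both orders nonempty: without them the empty tuples
    would be m-close for all m even if just one of the orders is empty. *)
Lemma close_sat dI dJ (I : orderType dI) (J : orderType dJ)
    (i0 : I) (j0 : J) k (phi : formula order_language k) :
  exists m, forall (a : k.-tuple (blocks I)) (b : k.-tuple (blocks J)),
    close m a b ->
    (@sat _ (order_structure (blocks I)) _ phi a <->
     @sat _ (order_structure (blocks J)) _ phi b).
Proof.
elim: phi => {k} /= [k|k s t|k r ts|k phi [m1 IH1] psi [m2 IH2]|k phi [m IH]].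
- by exists 0.
- (* A term is a variable, and an equality is the failure of both strict
     comparisons. *)
  exists 0 => a b ab; case: s => [i|[]]; case: t => [j|[]] /=.
  have lt_ab i' j' : (tnth a i' < tnth a j')%O = (tnth b i' < tnth b j')%O.
    by have := ab i' j' 0%R isT; rewrite !shift0.
  have eqE (d : Order.disp_t) (T : orderType d) (u v : T) :
      u = v <-> ~~ (u < v)%O /\ ~~ (v < u)%O.
    rewrite -!leNgt; split=> [->|[vu uv]]; first by [].
    by apply: le_anti; rewrite uv vu.
  by rewrite !eqE !lt_ab.
- exists 0 => a b ab; rewrite !tnth_mktuple.
  case: (ts ord0) (ts ord_max) => [i|[]] [j|[]] /=.
  by have := ab i j 0%R isT; rewrite !shift0 => ->.
- exists (maxn m1 m2) => a b ab.
  rewrite (IH1 a b) ?(IH2 a b) //; apply: close_sub ab.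
    exact: leq_maxr.
  exact: leq_maxl.
- exists m.+1.*2.+1 => a b ab; split=> sat_phi x.
    have [y yx] := close_extend x (i0, 0%R : int) (close_sym ab).
    exact/(IH _ _ (close_sym yx)).
  have [y xy] := close_extend x (j0, 0%R : int) ab.
  exact/(IH _ _ xy).
Qed.

(** Such tuples are m-close for every m. *)
Lemma tp_blocks dI dJ (I : orderType dI) (J : orderType dJ) (i0 : I) (j0 : J)
    k (a : k.-tuple (blocks I)) (b : k.-tuple (blocks J)) :
  (forall i j, ((tnth a i).1 <= (tnth a j).1)%O = ((tnth b i).1 <= (tnth b j).1)%O) ->
  (forall i, (tnth a i).2 = (tnth b i).2) ->
  @tp _ (order_structure (blocks I)) _ a = @tp _ (order_structure (blocks J)) _ b.
Proof.
move=> ab1 ab2; apply/seteqP.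
suff sat_ab phi : @sat _ (order_structure (blocks I)) _ phi a <->
                  @sat _ (order_structure (blocks J)) _ phi b.
  by split=> phi /sat_ab.
have [m] := close_sat i0 j0 phi; apply=> i j c _.
by rewrite !ltEprodlexi /= !ab1 !ab2.
Qed.

Lemma isotypic_nat_int :
  isotypic (order_structure (blocks nat)) (order_structure (blocks int)).
Proof.
split=> k c.
  pose f (p : blocks nat) : blocks int := (Posz p.1, p.2).
  exists (map_tuple f c).
  by apply: (@tp_blocks _ _ nat int 0%N 0%R) => [i j|i]; rewrite !tnth_map.
(* Translating by N makes all the block indices of the tuple nonnegative. *)
pose N := \max_(i < k) `|(tnth c i).1|%N.
pose f (p : blocks int) : blocks nat := (`|(p.1 + Posz N)%R|%N, p.2).
exists (map_tuple f c).
have bound i : `|(tnth c i).1|%N <= N by exact: (leq_bigmax i).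
apply: (@tp_blocks _ _ nat int 0%N 0%R) => [i j|i]; rewrite !tnth_map //=.
rewrite leEnat; have := bound i; have := bound j.
move: (tnth c i) (tnth c j) => [u ?] [v ?] /=; lia.
Qed.

(** By [le_shift1], [shift 1 x] is the least point above x, which the order
    determines; iterating, h maps each block into a single block. *)
Lemma iso_shift1 dI dJ (I : orderType dI) (J : orderType dJ)
    (h : blocks I -> blocks J) :
  bijective h -> (forall x y, (h x < h y)%O = (x < y)%O) ->
  forall x, h (shift 1%R x) = shift 1%R (h x).
Proof.
move=> [g _ hg] hlt x; apply: le_anti.
rewrite le_shift1 hlt -le_shift1 lexx andbT.
by rewrite -[shift _ (h x)]hg leNgt hlt -leNgt le_shift1 -hlt hg -le_shift1.
Qed.

Lemma not_isomorphic_nat_int :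
  ~ isomorphic (order_structure (blocks nat)) (order_structure (blocks int)).
Proof.
move=> [h [bij_h _ h_lt]].
have hlt (x y : blocks nat) : (h x < h y)%O = (x < y)%O.
  have := h_lt tt [tuple x; y].
  rewrite /= !tnth_map /tnth /= => E.
  by apply/idP/idP => /E.
have hS := iso_shift1 bij_h hlt.
have hD n x : h (shift (Posz n) x) = shift (Posz n) (h x).
  elim: n => [|n IH]; first by rewrite !shift0.
  by rewrite -addn1 PoszD -!shiftD hS IH.
(* The preimage of a point y in the block just before that of h (0, 0) is below
   (0, 0), hence in the first block, so (0, 0) is one of its shifts and h (0, 0)
   is in the block of y. *)
have [g _ hg] := bij_h.
pose y : blocks int := (((h (0%N, 0%R)).1 - 1)%R, 0%R).
have : (g y < (0%N, 0%R : int))%O by rewrite -hlt hg ltEprodlexi /=; lia.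
rewrite ltEprodlexi /= leEnat leqn0 => /andP[/eqP gy1 gy2].
have := hD `|(g y).2|%N (g y).
have -> : shift `|(g y).2|%N (g y) = (0%N, 0%R).
  by rewrite /shift gy1; congr pair; move: gy2; case: (g y) => u v /=; lia.
rewrite hg => /(congr1 fst) /=; lia.
Qed.

Theorem theorem3p1 :
  exists (dA dB : Order.disp_t) (A : orderType dA) (B : orderType dB),
    [/\ countable [set: A], countable [set: B],
        isotypic (order_structure A) (order_structure B) &
        ~ isomorphic (order_structure A) (order_structure B)].
Proof.
exists _, _, (blocks nat), (blocks int); split.
- exact: (@countableP (nat * int)%type).
- exact: (@countableP (int * int)%type).
- exact: isotypic_nat_int.
- exact: not_isomorphic_nat_int.
Qed.
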